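(* Let $K$ be a number field with ring of integers $\mathcal{O}_K$ and ideal class group $G = Cl(K)$ of order $h = |Cl(K)|$. Let $\alpha \in \mathcal{O}_K$ be non-zero and let $(\alpha) = \mathfrak{p}_1^{e_1} \cdots \mathfrak{p}_g^{e_g}$ be the prime ideal factorization of $(\alpha)$, with $\mathfrak{p}_1,\dots,\mathfrak{p}_g$ distinct. The number $n(\alpha)$ of principal ideal divisors of $(\alpha)$ is given by $$n(\alpha) = \frac{1}{h} \sum_{\chi \in \hat{G}} \prod_{i=1}^{g} \left( \sum_{k=0}^{e_i} \chi([\mathfrak{p}_i])^k \right).$$
   Context: $[\mathfrak{p}]$ denotes the class of the ideal $\mathfrak{p}$ in $Cl(K)$, and $\hat{G}$ is the group of all group homomorphisms $\chi : G \to \mathbb{C}^*$. For a non-zero ideal $I = \prod_{i=1}^g \mathfrak{p}_i^{e_i}$ (factorization into powers of distinct primes), an ideal divisor of $I$ is an ideal of the form $J = \prod_{i=1}^g \mathfrak{p}_i^{f_i}$ with $0 \le f_i \le e_i$; it is a principal ideal divisor if $J = (a)$ for some $a \in \mathcal{O}_K$. The ideals $\mathcal{O}_K = (1)$ and, when $I$ is principal, $I$ itself count as principal ideal divisors. *)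

(* Defs.v *)
From HB Require Import structures.
From mathcomp Require Import all_boot all_order all_algebra all_field.
From mathcomp Require Import finmap.
From mathcomp Require Import boolp classical_sets functions cardinality fsbigop.
From mathcomp Require Import reals.
From mathcomp.real_closed Require Import complex.

Set Implicit Arguments.
Unset Strict Implicit.
Unset Printing Implicit Defensive.

Import GRing.Theory.

Local Open Scope classical_set_scope.
Local Open Scope ring_scope.

(* The ring of integers of a number field [K : fieldExtType rat]. *)

Section RingOfIntegers.
Variable K : fieldExtType rat.

Definition algint : {pred K} := fun x => `[< integralOver (intr : int -> K) x >].

Fact algint_subring_closed : subring_closed algint.
Proof.
split=> [|x y /asboolP xint /asboolP yint|x y /asboolP xint /asboolP yint].
- exact/asboolP/integral1.
- exact/asboolP/integral_sub.
- exact/asboolP/integral_mul.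
Qed.

HB.instance Definition _ :=
  GRing.isSubringClosed.Build K algint algint_subring_closed.

Record ringOfIntegers : predArgType :=
  RingOfIntegers { algint_val : K; _ : algint_val \in algint }.

HB.instance Definition _ := [isSub for algint_val].
HB.instance Definition _ := [Choice of ringOfIntegers by <:].
HB.instance Definition _ := [SubChoice_isSubComNzRing of ringOfIntegers by <:].

Lemma ringOfIntegers_mulf_neq0 (a b : ringOfIntegers) :
  a != 0 -> b != 0 -> a * b != 0.
Proof.
rewrite -!(inj_eq val_inj) !(rmorph0, rmorphM) => a0 b0.
exact: mulf_neq0.
Qed.

End RingOfIntegers.

(* Ideals of a commutative ring form a commutative semiring for the sum and
   the product of ideals: [0] is the zero ideal, [1] the unit ideal, and
   [\prod] and [^+] are products and powers of ideals. *)

Section Ideals.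
Variable R : comNzRingType.

Definition ideal_axiom (I : set R) : Prop :=
  [/\ I 0, forall x y, I x -> I y -> I (x + y) & forall a x, I x -> I (a * x)].

Record ideal := Ideal { ideal_set :> R -> Prop; ideal_setP : ideal_axiom ideal_set }.

HB.instance Definition _ := gen_eqMixin ideal.
HB.instance Definition _ := gen_choiceMixin ideal.

Implicit Types I J L : ideal.

Lemma idealP I J : (forall x, I x <-> J x) -> I = J.
Proof.
case: I J => [I hI] [J hJ] /= eqIJ.
have eIJ : I = J by apply/funext => x; exact/propext.
by case: _ / eIJ hJ => hJ; congr Ideal; exact: Prop_irrelevance.
Qed.

Lemma ideal0 I : I 0. Proof. by case: I => ? []. Qed.
Lemma idealD I x y : I x -> I y -> I (x + y).
Proof. by case: I => ? [? + ?]; apply. Qed.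
Lemma idealMl I a x : I x -> I (a * x).
Proof. by case: I => ? [? ? +]; apply. Qed.
Lemma ideal_sum I n (f : 'I_n -> R) : (forall i, I (f i)) -> I (\sum_i f i).
Proof.
move=> fI; elim/big_ind: _ => // [|x y]; [exact: ideal0|exact: idealD].
Qed.

Fact principal_subproof (a : R) : ideal_axiom [set x | exists r, x = r * a].
Proof.
split=> [|_ _ [r ->] [s ->]|b _ [r ->]].
- by exists 0; rewrite mul0r.
- by exists (r + s); rewrite mulrDl.
- by exists (b * r); rewrite mulrA.
Qed.
Definition principal a := Ideal (principal_subproof a).

Fact ideal_add_subproof I J :
  ideal_axiom [set x | exists2 y, I y & exists2 z, J z & x = y + z].
Proof.
split=> [|_ _ [y Iy [z Jz ->]] [y' Iy' [z' Jz' ->]]|a _ [y Iy [z Jz ->]]].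
- by exists 0; [exact: ideal0|exists 0; [exact: ideal0|rewrite addr0]].
- exists (y + y'); first exact: idealD.
  by exists (z + z'); [exact: idealD|rewrite addrACA].
- exists (a * y); first exact: idealMl.
  by exists (a * z); [exact: idealMl|rewrite mulrDr].
Qed.
Definition ideal_add I J := Ideal (ideal_add_subproof I J).

Fact ideal_mul_subproof I J : ideal_axiom
  [set x | exists n (a b : 'I_n -> R),
     [/\ forall i, I (a i), forall i, J (b i) & x = \sum_i a i * b i]].
Proof.
split=> [|_ _ [n [a [b [Ia Jb ->]]]] [m [c [d [Ic Jd ->]]]]
         |r _ [n [a [b [Ia Jb ->]]]]].
- by exists 0%N, (fun=> 0), (fun=> 0); split=> [[]//|[]//|]; rewrite big_ord0.
- pose cat (f : 'I_n -> R) (g : 'I_m -> R) (i : 'I_(n + m)) :=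
    match fintype.split i with inl j => f j | inr k => g k end.
  exists (n + m)%N, (cat a c), (cat b d); split=> [i|i|].
  + by rewrite /cat; case: fintype.split.
  + by rewrite /cat; case: fintype.split.
  + rewrite big_split_ord /cat /=; congr (_ + _); apply: eq_bigr => i _.
    * by rewrite (unsplitK (inl _ i)).
    * by rewrite (unsplitK (inr _ i)).
- exists n, (fun i => r * a i), b; split=> // [i|]; first exact: idealMl.
  by rewrite mulr_sumr; apply: eq_bigr => i _; rewrite mulrA.
Qed.
Definition ideal_mul I J := Ideal (ideal_mul_subproof I J).

Lemma mem_ideal_mul I J a b : I a -> J b -> ideal_mul I J (a * b).
Proof.
by move=> Ia Jb; exists 1%N, (fun=> a), (fun=> b); rewrite big_ord1.
Qed.

Lemma ideal_mul_sub I J L : (forall a b, I a -> J b -> L (a * b)) ->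
  forall x, ideal_mul I J x -> L x.
Proof.
by move=> IJL x [n [a [b [Ia Jb ->]]]]; apply: ideal_sum => i; exact: IJL.
Qed.

Fact ideal_addA : associative ideal_add.
Proof.
move=> I J L; apply: idealP => x; split.
- move=> [a Ia [_ [b Jb [c Lc ->]] ->]].
  by exists (a + b); [exists a => //; exists b|exists c; rewrite ?addrA].
- move=> [_ [a Ia [b Jb ->]] [c Lc ->]].
  by exists a => //; exists (b + c); [exists b => //; exists c|rewrite addrA].
Qed.

Fact ideal_addC : commutative ideal_add.
Proof.
move=> I J; apply: idealP => x; split=> -[a Ia [b Jb ->]];
  by exists b => //; exists a => //; rewrite addrC.
Qed.

Fact ideal_add0 : left_id (principal 0) ideal_add.
Proof.
move=> I; apply: idealP => x; split=> [[_ [r ->] [b Ib ->]]|Ix].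
- by rewrite mulr0 add0r.
- by exists 0; [exact: ideal0|exists x; rewrite ?add0r].
Qed.

Fact ideal_mulC : commutative ideal_mul.
Proof.
by move=> I J; apply: idealP => x; split; apply: ideal_mul_sub => a b Ia Jb;
  rewrite mulrC; exact: mem_ideal_mul.
Qed.

Fact ideal_mulA : associative ideal_mul.
Proof.
have sub I J L x : ideal_mul I (ideal_mul J L) x -> ideal_mul (ideal_mul I J) L x.
  apply: ideal_mul_sub => a _ Ia [n [b [c [Jb Lc ->]]]].
  rewrite mulr_sumr; apply: ideal_sum => i; rewrite mulrA.
  by apply: mem_ideal_mul => //; exact: mem_ideal_mul.
move=> I J L; apply: idealP => x; split; first exact: sub.
by rewrite ideal_mulC (ideal_mulC I J) => /sub; rewrite ideal_mulC (ideal_mulC L).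
Qed.

Fact ideal_mul1 : left_id (principal 1) ideal_mul.
Proof.
move=> I; apply: idealP => x; split=> [|Ix].
- by apply: ideal_mul_sub => _ b [r ->] Ib; rewrite mulr1; exact: idealMl.
- by rewrite -[x]mul1r; apply: mem_ideal_mul => //; exists 1; rewrite mulr1.
Qed.

Fact ideal_mulDl : left_distributive ideal_mul ideal_add.
Proof.
move=> I J L; apply: idealP => x; split.
- apply: ideal_mul_sub => _ c [a Ia [b Jb ->]] Lc; rewrite mulrDl.
  exists (a * c); first exact: mem_ideal_mul.
  by exists (b * c) => //; exact: mem_ideal_mul.
- move=> [_ [n [a [c [Ia Lc ->]]]] [_ [m [b [d [Jb Ld ->]]]] ->]].
  apply: idealD; apply: ideal_sum => i; apply: mem_ideal_mul => //.
  + by exists (a i) => //; exists 0; [exact: ideal0|rewrite addr0].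
  + by exists 0; [exact: ideal0|exists (b i); rewrite ?add0r].
Qed.

Fact ideal_mul0 : left_zero (principal 0) ideal_mul.
Proof.
move=> I; apply: idealP => x; split=> [|[r ->]]; last first.
  by rewrite mulr0; exact: ideal0.
by apply: ideal_mul_sub => _ b [r ->] _; exists 0; rewrite mulr0 !mul0r.
Qed.

Fact ideal1_neq0 : principal 1 != principal 0.
Proof.
apply/eqP => e; have : principal 1 1 by exists 1; rewrite mulr1.
by rewrite e => -[r]; rewrite mulr0 => /eqP; rewrite oner_eq0.
Qed.

HB.instance Definition _ :=
  GRing.isNmodule.Build ideal ideal_addA ideal_addC ideal_add0.
HB.instance Definition _ := GRing.Nmodule_isComNzSemiRing.Build ideal
  ideal_mulA ideal_mulC ideal_mul1 ideal_mulDl ideal_mul0 ideal1_neq0.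

Lemma ideal_neq0P I : reflect (exists2 a, I a & a != 0) (I != 0).
Proof.
apply: (iffP idP) => [I0|[a Ia a0]]; last first.
  by apply/eqP => e; move: Ia a0; rewrite e => -[r ->]; rewrite mulr0 eqxx.
apply: contrapT => noa; move/eqP: I0; apply; apply: idealP => x; split.
- move=> Ix; exists 0; rewrite mul0r; apply/eqP; apply: contrapT => /negP x0.
  by apply: noa; exists x.
- by move=> [r ->]; rewrite mulr0; exact: ideal0.
Qed.

Lemma principalM a b : principal a * principal b = principal (a * b).
Proof.
apply: idealP => x; split.
- apply: ideal_mul_sub => _ _ [r ->] [s ->].
  by exists (r * s); rewrite mulrACA.
- move=> [r ->]; rewrite mulrA; apply: mem_ideal_mul; first by exists r.
  by exists 1; rewrite mul1r.
Qed.

Lemma principal1 : principal 1 = 1. Proof. by []. Qed.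

Definition is_principal I : Prop := exists a, I = principal a.

Definition is_prime I : Prop :=
  ~ I 1 /\ forall a b, I (a * b) -> I a \/ I b.

(* [I] is the product of the [p i ^+ e i], with the [p i] distinct primes. *)
Definition prime_factorization I g (p : 'I_g -> ideal) (e : 'I_g -> nat) : Prop :=
  [/\ injective p, forall i, is_prime (p i), forall i, (0 < e i)%N
    & I = \prod_(i < g) p i ^+ e i].

Definition ideal_divisor I J : Prop :=
  exists g (p : 'I_g -> ideal) (e f : 'I_g -> nat),
    [/\ prime_factorization I p e, forall i, (f i <= e i)%N
      & J = \prod_(i < g) p i ^+ f i].

(* The set is finite as soon as [a] is a nonzero element of a ring of integers;
   [fset_set] would be empty on an infinite set. *)
Definition num_principal_divisors (a : R) : nat :=
  #|` fset_set [set J | ideal_divisor (principal a) J /\ is_principal J]|.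

End Ideals.

(* The class group: nonzero ideals [I], [J] have the same class when
   [(a) I = (b) J] for some nonzero [a], [b]. *)

Section ClassGroup.
Variable K : fieldExtType rat.

Record nzideal : predArgType :=
  NzIdeal { nzideal_val :> ideal (ringOfIntegers K); nzidealP : nzideal_val != 0 }.

HB.instance Definition _ := [isSub for nzideal_val].
HB.instance Definition _ := [Choice of nzideal by <:].

Fact nzideal_one_subproof : (1 : ideal (ringOfIntegers K)) != 0.
Proof. exact: oner_neq0. Qed.
Definition nzideal_one := NzIdeal nzideal_one_subproof.

Fact nzideal_mul_subproof (I J : nzideal) : (I : ideal (ringOfIntegers K)) * J != 0.
Proof.
case: I J => [I /ideal_neq0P[a Ia a0]] [J /ideal_neq0P[b Jb b0]] /=.
apply/ideal_neq0P; exists (a * b); first exact: mem_ideal_mul.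
exact: ringOfIntegers_mulf_neq0.
Qed.
Definition nzideal_mul I J := NzIdeal (nzideal_mul_subproof I J).

Definition class_equiv (I J : nzideal) : bool :=
  `[< exists a b : ringOfIntegers K, [/\ a != 0, b != 0
        & principal a * (I : ideal _) = principal b * (J : ideal _)] >].

Fact class_equiv_refl : reflexive class_equiv.
Proof.
by move=> I; apply/asboolP; exists 1, 1; split=> //; exact: oner_neq0.
Qed.

Fact class_equiv_sym : symmetric class_equiv.
Proof.
by move=> I J; apply/asboolP/asboolP => -[a [b [a0 b0 e]]]; exists b, a.
Qed.

Fact class_equiv_trans : transitive class_equiv.
Proof.
move=> J I L /asboolP[a [b [a0 b0 e]]] /asboolP[c [d [c0 d0 e']]].
apply/asboolP; exists (c * a), (b * d).
split; try exact: ringOfIntegers_mulf_neq0.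
by rewrite -!principalM -!mulrA e -e' mulrCA.
Qed.

Canonical class_equiv_rel :=
  EquivRel class_equiv class_equiv_refl class_equiv_sym class_equiv_trans.

Definition class_group := {eq_quot class_equiv_rel}%qT.
HB.instance Definition _ := Choice.on class_group.
HB.instance Definition _ := EqQuotient.on class_group.

Definition ideal_class (I : nzideal) : class_group := \pi_class_group%qT I.

Definition class_one : class_group := ideal_class nzideal_one.
Definition class_mul (x y : class_group) : class_group :=
  ideal_class (nzideal_mul (repr x) (repr y)).

Lemma ideal_classP (I J : nzideal) :
  ideal_class I = ideal_class J <-> class_equiv I J.
Proof. by split=> [/eqquotP|?]; [|exact/eqquotP]. Qed.

Lemma ideal_classM (I J : nzideal) :
  ideal_class (nzideal_mul I J) = class_mul (ideal_class I) (ideal_class J).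
Proof.
have eqr (L : nzideal) : class_equiv L (repr (ideal_class L)).
  by apply/ideal_classP; rewrite /ideal_class reprK.
apply/ideal_classP/asboolP.
have /asboolP[a [b [a0 b0 e]]] := eqr I.
have /asboolP[c [d [c0 d0 e']]] := eqr J.
exists (a * c), (b * d); split; try exact: ringOfIntegers_mulf_neq0.
by rewrite -!principalM /= mulrACA e e' mulrACA.
Qed.

Lemma ideal_class_repr (x : class_group) : ideal_class (repr x) = x.
Proof. by rewrite /ideal_class reprK. Qed.

Fact class_mulA : associative class_mul.
Proof.
move=> x y z; rewrite -[x]ideal_class_repr -[y]ideal_class_repr.
rewrite -[z]ideal_class_repr -!ideal_classM; congr ideal_class.
by apply: val_inj; rewrite /= mulrA.
Qed.

Fact class_mulC : commutative class_mul.
Proof.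
move=> x y; rewrite -[x]ideal_class_repr -[y]ideal_class_repr.
by rewrite -!ideal_classM; congr ideal_class; apply: val_inj; rewrite /= mulrC.
Qed.

Fact class_mul1 : left_id class_one class_mul.
Proof.
move=> x; rewrite -[x]ideal_class_repr -ideal_classM; congr ideal_class.
by apply: val_inj; rewrite /= mul1r.
Qed.

Fact class_1mul : right_id class_one class_mul.
Proof. by move=> x; rewrite class_mulC class_mul1. Qed.

HB.instance Definition _ :=
  isMonoid.Build class_group class_mulA class_mul1 class_1mul.

(* [fset_set] would be empty if the class group were infinite, so that the
   finiteness of the class group is not built into this definition. *)
Definition class_number : nat := #|` fset_set [set: class_group]|.

End ClassGroup.

(* For the class group, which is a group, these are the group homomorphisms
   [G -> C^*]; they are encoded as nowhere vanishing multiplicative maps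
   into the field [C]. *)
Definition characters (G : monoidType) (C : fieldType) : set (G -> C) :=
  [set chi | (forall x, chi x != 0)
             /\ forall x y, chi (x * y)%g = chi x * chi y].

Arguments characters : clear implicits.

(* Main.v *)
(* For a character chi of the class group, the inner product expands to the sum,
   over the exponent vectors f <= e, of chi evaluated at the class of the product
   of the p_i^f_i.  By unique factorization these products are the ideal divisors
   of (alpha), each obtained once, and the sum over all chi of chi(x) is h if x is
   trivial and 0 otherwise.

   The orthogonality relation comes from diagonalizing simultaneously the regular
   representation: its diagonal entries are h characters whose sum is its trace,
   and pairing this trace with any character shows that each occurs exactly once.

   The class group is finite by Hurwitz's argument: for some M, every x in K is
   such that, for some 0 < t <= M, t x differs from an algebraic integer by an
   element of norm < 1, so that every ideal class has a member containing a
   fixed integer N.  Inverse classes come from the same finiteness: two powers of an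
   ideal are equivalent, and the determinant trick turns I^i ~ I^j into the
   principality of I^(j-i). *)

Require Import Defs.
From HB Require Import structures.
From mathcomp Require Import all_boot all_order all_algebra all_fingroup all_field.
From mathcomp Require Import finmap.
From mathcomp Require Import boolp classical_sets functions cardinality fsbigop.
From mathcomp Require Import reals.
From mathcomp.real_closed Require Import complex.

Set Implicit Arguments.
Unset Strict Implicit.
Unset Printing Implicit Defensive.

From mathcomp Require Import ring lra zify.
Import Order.TTheory GRing.Theory Num.Theory.
Local Open Scope classical_set_scope.
Local Open Scope ring_scope.

(** * Characters of a finite commutative group *)

Section Characters.
Variables (G : monoidType) (C : numClosedFieldType) (h' : nat).
Let h := h'.+1.
Variables (en : 'I_h -> G) (rk : G -> 'I_h).
Hypotheses (enK : cancel en rk) (rkK : cancel rk en).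
Hypothesis mulC : commutative (@mul G).
Hypothesis mulV : forall x : G, exists y, (x * y)%g = 1%g.

Lemma monoid_mulI (x : G) : injective (mul x).
Proof.
move=> y z exy; have [w xw] := mulV x.
have wK u : (w * (x * u))%g = u by rewrite monoid.mulgA (mulC w) xw monoid.mul1g.
by rewrite -[y]wK exy wK.
Qed.

Fact translation_inj (x : G) : injective (fun i => rk (x * en i)%g).
Proof. by move=> i j /(can_inj rkK) /monoid_mulI /(can_inj enK). Qed.

Definition translation (x : G) : 'S_h := perm (@translation_inj x).

Lemma translationM x y : translation (x * y)%g = (translation x * translation y)%g.
Proof.
by apply/permP => i; rewrite permM !permE rkK monoid.mulgA (mulC x y).
Qed.

Definition regular_mx (x : G) : 'M[C]_h := perm_mx (translation x).

Lemma regular_mxM x y : regular_mx (x * y)%g = regular_mx x *m regular_mx y.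
Proof. by rewrite /regular_mx translationM perm_mxM. Qed.

(** A translation by [x] other than 1 has no fixed point, since [x * y = y] can be cancelled. *)
Lemma regular_mx_trace x :
  \tr (regular_mx x) = if x == 1%g then h%:R else 0.
Proof.
rewrite /mxtrace; have [->|x1] := eqVneq x 1%g.
  rewrite (eq_bigr (fun=> 1)) ?sumr_const ?card_ord// => i _.
  by rewrite !mxE permE monoid.mul1g enK eqxx.
rewrite big1// => i _; rewrite !mxE permE; case: eqP => // e.
case/eqP: x1; have := rkK (x * en i)%g; rewrite e => e'.
by apply: (@monoid_mulI (en i)); rewrite monoid.mulg1 mulC -e'.
Qed.

(** The translation has finite order [N], so the minimal polynomial divides X^N - 1, which splits
    over [C] and is separable in characteristic 0. *)
Lemma regular_mx_diag x : diagonalizable (regular_mx x).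
Proof.
pose N := #[translation x]%g; have N0 : (0 < N)%N by exact: order_gt0.
have RN : regular_mx x ^+ N = 1.
  have -> n : regular_mx x ^+ n = perm_mx (translation x ^+ n)%g.
    elim: n => [|n IHn]; first by rewrite expr0 expg0 perm_mx1.
    by rewrite exprS IHn expgS perm_mxM.
  by rewrite expg_order perm_mx1.
have [rs rsE] := closed_field_poly_normal ('X^N - 1 : {poly C}).
have lc1 : lead_coef ('X^N - 1 : {poly C}) = 1.
  by apply/eqP; rewrite -monicE monicXnsubC.
rewrite lc1 scale1r in rsE.
apply/diagonalizableP; exists rs; first last.
  by apply: mxminpoly_min; rewrite -rsE rmorphB rmorphXn rmorph1 /= horner_mx_X RN subrr.
by rewrite -separable_prod_XsubC -rsE separable_Xn_sub_1// pnatr_eq0 -lt0n.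
Qed.

Lemma char_one (chi : G -> C) : characters G C chi -> chi 1%g = 1.
Proof.
move=> [chi0 chiM]; apply: (mulfI (chi0 1%g)).
by rewrite -chiM monoid.mulg1 mulr1.
Qed.

(** Reindexing by the translation by some [y] with [chi y != 1] shows that multiplication by [chi y]
    fixes the sum. *)
Lemma char_sum (chi : G -> C) : characters G C chi ->
  \sum_i chi (en i) = if chi == (fun=> 1) then h%:R else 0.
Proof.
move=> [chi0 chiM]; have [->|] := eqVneq chi; first by rewrite sumr_const card_ord.
move=> chi1; have [y chiy] : exists y, chi y != 1.
  apply: contrapT => no; case/eqP: chi1; apply/funext => y.
  by apply/eqP; apply: contrapT => /negP ?; apply: no; exists y.
have : chi y * \sum_i chi (en i) = \sum_i chi (en i).
  rewrite mulr_sumr [RHS](reindex_inj (@translation_inj y)) /=.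
  by apply: eq_bigr => i _; rewrite rkK chiM.
rewrite -[X in _ = X]mul1r => /eqP.
by rewrite -subr_eq0 -mulrBl mulf_eq0 subr_eq0 (negPf chiy) => /eqP.
Qed.

Lemma character_enum : exists chi : 'I_h -> G -> C,
  set_bij [set: 'I_h] (characters G C) chi
  /\ forall x, \sum_i chi i x = if x == 1%g then h%:R else 0.
Proof.
have [P Pu /allP PD] : codiagonalizable [seq regular_mx (en i) | i <- enum 'I_h].
  apply/codiagonalizableP; split=> [_ _ /mapP[i _ ->] /mapP[j _ ->]|_ /mapP[i _ ->]].
    by rewrite /comm_mx -!regular_mxM mulC.
  exact: regular_mx_diag.
pose D x := conjmx P (regular_mx x).
have DE x : D x = P *m regular_mx x *m invmx P by rewrite /D conjumx.
have Ddiag x i j : i != j -> D x i j = 0.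
  have /(_ _)/is_diag_mxP := PD (regular_mx x); apply.
  by rewrite -[x]rkK; apply/mapP; exists (rk x); rewrite ?mem_enum.
have DM x y : D (x * y)%g = D x *m D y.
  by rewrite !DE regular_mxM !mulmxA mulmxKV.
(* [D 1] is idempotent and invertible. *)
have D1 : D 1%g = 1%:M.
  have := DM 1%g 1%g; rewrite monoid.mulg1 => e.
  have Du : D 1%g \in unitmx.
    by rewrite DE !unitmx_mul unitmx_inv Pu unitmx_perm.
  by rewrite -(mulmxV Du) {2}e mulmxK.
pose chi i x := D x i i.
have chiM i x y : chi i (x * y)%g = chi i x * chi i y.
  rewrite /chi DM mxE (bigD1 i) //= big1 ?addr0// => j ji.
  by rewrite Ddiag ?mul0r// eq_sym.
have chiC i : characters G C (chi i).
  split=> [x|]; last exact: chiM.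
  have [y xy] := mulV x; have := chiM i x y.
  rewrite xy {1}/chi D1 mxE eqxx => /esym/eqP; apply: contraTneq => ->.
  by rewrite mul0r eq_sym oner_neq0.
have chi_sum x : \sum_i chi i x = if x == 1%g then h%:R else 0.
  rewrite -regular_mx_trace -[LHS]/(\tr (D x)) DE mxtrace_mulC mulmxA mulVmx//.
  by rewrite mul1mx.
have h0 : h%:R != 0 :> C by rewrite pnatr_eq0.
(* The trace is paired with the inverse of [psi] in two ways: it is concentrated at 1, which gives
   [h]; term by term, [char_sum] gives [h] for each [i] with [chi i = psi] and 0 for the others. *)
have count1 psi : characters G C psi -> #|[pred i | chi i == psi]| = 1%N.
  move=> psiC; have [psi0 psiM] := psiC; have psi1 := char_one psiC.
  have chi_div i : characters G C (fun x => chi i x / psi x).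
    have [chi0 _] := chiC i.
    split=> [x|x y]; first by rewrite mulf_neq0 ?invr_neq0.
    by rewrite chiM psiM invfM mulrACA.
  have : \sum_j (psi (en j))^-1 * \sum_i chi i (en j) = h%:R.
    rewrite (bigD1 (rk 1%g)) //= rkK psi1 invr1 mul1r chi_sum eqxx.
    rewrite big1 ?addr0// => j j1; rewrite chi_sum ifF ?mulr0//.
    by apply/negbTE; apply: contra j1 => /eqP <-; rewrite enK.
  under eq_bigr do rewrite mulr_sumr.
  rewrite exchange_big /= (eq_bigr (fun i => if chi i == psi then h%:R else 0)).
    rewrite -big_mkcond /= sumr_const => e.
    by apply/eqP; rewrite -(eqr_nat C) -(inj_eq (mulIf h0)) mul1r mulr_natl e.
  move=> i _; under eq_bigr do rewrite mulrC.
  rewrite (char_sum (chi_div i)); congr (if _ then _ else _).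
  apply/eqP/eqP => [e|->]; apply/funext => x.
    by have /(congr1 (fun f => f x))/divr1_eq := e.
  by rewrite divff.
exists chi; split=> //; split.
- by [].
- move=> i j _ _ e; have := count1 _ (chiC i).
  by move/eqP; rewrite eqn_leq => /andP[/card_le1_eqP le1 _]; apply: le1; rewrite inE ?e.
- move=> psi psiC; have : (0 < #|[pred i | chi i == psi]|)%N by rewrite count1.
  by case/card_gt0P => i /eqP <-; exists i.
Qed.
End Characters.

(** * The lattice spanned by an integral basis *)

Lemma common_denominator (I : finType) (F : I -> rat) :
  exists2 d, (0 < d)%N & forall i, d%:R * F i \is a Num.int.
Proof.
exists (\prod_i `|denq (F i)|)%N.
  by rewrite prodn_gt0// => i; rewrite absz_gt0 denq_neq0.
move=> i; rewrite (bigD1 i) //= natrM -mulrA mulrCA; apply: rpredM.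
  exact: rpred_nat.
suff -> : (`|denq (F i)|%N)%:R * F i = (numq (F i))%:~R by exact: intr_int.
rewrite -{2}[F i]divq_num_den mulrCA natr_absz ger0_norm ?denq_ge0//.
by rewrite divff ?mulr1// intr_eq0 denq_neq0.
Qed.

(** [x] is a root of the characteristic polynomial, which is monic over [A]. The transpose appears
    because [eigenvalueP] speaks of row vectors. *)
Lemma integral_eigenvalue (A : comNzRingType) (F : fieldType)
    (f : {rmorphism A -> F}) n (M : 'M[A]_n) (v : 'cV[F]_n) x :
  v != 0 -> map_mx f M *m v = x *: v -> integralOver f x.
Proof.
move=> v0 Mv; exists (char_poly M^T); first exact: char_poly_monic.
rewrite map_char_poly -eigenvalue_root_char; apply/eigenvalueP.
exists v^T; last by rewrite trmx_eq0.
by rewrite -map_trmx -trmx_mul Mv linearZ.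
Qed.

(** Any basis [v] is scaled by a common denominator [c] of its structure constants: those of [c v]
    are [c] times those of [v]. The result need not span the ring of integers over Z. *)
Lemma integral_basis (K : fieldExtType rat) :
  exists n (w : n.+1.-tuple K), basis_of {:K} w /\
    forall i j k : 'I_n.+1, coord w k (w`_i * w`_j) \is a Num.int.
Proof.
have [n [v bv]] : exists n (v : n.+1.-tuple K), basis_of {:K} v.
  have := vbasisP {:K}; have := adim_gt0 (fullv : {subfield K}).
  move: (vbasis _); case: (\dim _) => // n v _ bv.
  by exists n, v.
have [c c0 cP] := common_denominator
  (fun ijk : 'I_n.+1 * 'I_n.+1 * 'I_n.+1 => coord v ijk.2 (v`_ijk.1.1 * v`_ijk.1.2)).
have cr0 : c%:R != 0 :> rat by rewrite pnatr_eq0 -lt0n.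
pose w := [tuple c%:R *: v`_i | i < n.+1].
have wE (i : 'I_n.+1) : w`_i = c%:R *: v`_i.
  by rewrite -[w`_i](tnth_nth 0) tnth_mktuple.
have bw : basis_of {:K} w.
  rewrite basisEdim size_tuple (size_basis bv) leqnn andbT; apply/subvP => x _.
  rewrite (coord_basis bv (memvf x)); apply: memv_suml => i _.
  have -> : v`_i = c%:R^-1 *: w`_i by rewrite wE scalerA mulVf// scale1r.
  by rewrite !memvZ// memv_span// mem_nth// size_tuple.
exists n, w; split=> // i j k.
rewrite !wE -scalerAl -scalerAr.
rewrite [_ * _](coord_basis bv (memvf _)).
rewrite !scaler_sumr linear_sum rpred_sum// => l _.
have -> : v`_l = c%:R^-1 *: w`_l by rewrite wE scalerA mulVf// scale1r.
rewrite !linearZ /= coord_free ?(basis_free bw)//.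
rewrite (mulrCA _ c%:R^-1) mulVKf// mulrA; apply: rpredM; last exact: rpred_nat.
exact: cP (_, _, _).
Qed.

(** * Multiplication matrices and integrality of the trace *)

Section IntegralBasis.
Variables (K : fieldExtType rat) (n : nat) (w : n.+1.-tuple K).
Hypothesis bw : basis_of {:K} w.

Let expand (x : K) : x = \sum_i coord w i x *: w`_i := coord_basis bw (memvf x).

(** The determinant and the trace of this matrix are the norm and the trace of [x] over the
    rationals. *)
Definition mult_mx (x : K) : 'M[rat]_n.+1 := \matrix_(i, j) coord w j (x * w`_i).

Fact mult_mx_is_zmod_morphism : zmod_morphism mult_mx.
Proof.
by move=> x y; apply/matrixP => i j; rewrite !mxE mulrBl linearB.
Qed.

Fact mult_mx_is_monoid_morphism : monoid_morphism mult_mx.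
Proof.
split=> [|x y]; apply/matrixP => i j; rewrite !mxE.
  by rewrite mul1r coord_free ?(basis_free bw)// eq_sym.
rewrite -mulrA mulrCA [x * _]expand mulr_sumr linear_sum.
apply: eq_bigr => k _; rewrite !mxE -scalerAr linearZ //.
Qed.

HB.instance Definition _ :=
  GRing.isZmodMorphism.Build K 'M[rat]_n.+1 mult_mx mult_mx_is_zmod_morphism.
HB.instance Definition _ :=
  GRing.isMonoidMorphism.Build K 'M[rat]_n.+1 mult_mx mult_mx_is_monoid_morphism.

Lemma mult_mxZ a x : mult_mx (a *: x) = a *: mult_mx x.
Proof. by apply/matrixP => i j; rewrite !mxE -scalerAl linearZ. Qed.

Lemma mult_mx_unit x : x != 0 -> \det (mult_mx x) != 0.
Proof.
move=> x0; rewrite -unitfE -unitmxE.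
have : mult_mx x * mult_mx x^-1 = 1 by rewrite -rmorphM divff ?rmorph1.
by case/mulmx1_unit.
Qed.

(** The eigenvalues are roots of the monic integer polynomial that kills [x], so the trace is an
    algebraic integer; being rational, it is an integer. *)
Lemma trace_algint x : algint x -> \tr (mult_mx x) \is a Num.int.
Proof.
move=> /asboolP[q qm qx]; set M := mult_mx x.
pose f : {rmorphism rat -> algC} := ratr.
have dvM : mxminpoly M %| map_poly intr q.
  apply: mxminpoly_min; move/rootP: qx => /(congr1 mult_mx).
  rewrite rmorph0 -horner_map -map_poly_comp => <-.
  rewrite /horner_mx /horner_morph -map_poly_comp; congr (_.[_]).
  by apply: eq_map_poly => b /=; rewrite !rmorph_int.
have [rs rsE] := closed_field_poly_normal (map_poly f (char_poly M)).
have /monicP lc1 : map_poly f (char_poly M) \is monic.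
  by rewrite map_monic char_poly_monic.
rewrite lc1 scale1r in rsE.
have rsA z : z \in rs -> z \in Aint.
  rewrite -root_prod_XsubC -rsE map_char_poly -root_mxminpoly mxminpoly_map.
  move=> Mz; apply: (@root_monic_Aint (map_poly intr q)).
  - have -> : map_poly intr q = map_poly f (map_poly intr q) :> {poly algC}.
      by rewrite -map_poly_comp; apply: eq_map_poly => b /=; rewrite rmorph_int.
    by apply: root_dvdp Mz; rewrite dvdp_map.
  - exact: monic_map.
  - by apply/polyOverP => i; rewrite coef_map; exact: intr_int.
have srs : size rs = n.+1.
  by apply: succn_inj; rewrite -(size_prod_XsubC _ id) -rsE size_map_poly size_char_poly.
have : f (\tr M) = \sum_(z <- rs) z.
  rewrite -[LHS]opprK -rmorphN -char_poly_trace// -coef_map rsE.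
  by rewrite -srs coefPn_prod_XsubC ?srs// opprK.
move=> trE; have : f (\tr M) \in Num.int.
  apply: Cint_rat_Aint; first by exact: Crat_rat.
  by rewrite trE big_seq rpred_sum.
by rewrite /f Cint_rat.
Qed.

Lemma coord_natM k m x : coord w k (m%:R * x) = m%:R * coord w k x.
Proof. by rewrite !mulr_natl raddfMn. Qed.

Lemma trace_expand x z :
  \tr (mult_mx (x * z)) = \sum_k coord w k z * \tr (mult_mx (x * w`_k)).
Proof.
rewrite {1}[z]expand mulr_sumr rmorph_sum raddf_sum; apply: eq_bigr => k _.
by rewrite /= -scalerAr mult_mxZ linearZ.
Qed.

(** * The lattice, its index in the integers, and Hurwitz approximation *)

Hypothesis wM : forall i j k : 'I_n.+1, coord w k (w`_i * w`_j) \is a Num.int.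

(** The Z-span of [w]: closed under products and made of algebraic integers, but possibly without
    1. *)
Definition lattice (x : K) : Prop := forall k, coord w k x \is a Num.int.

Lemma latticeB x y : lattice x -> lattice y -> lattice (x - y).
Proof. by move=> lx ly k; rewrite linearB; apply: rpredB; [apply: lx|apply: ly]. Qed.

Lemma lattice_natM m x : lattice x -> lattice (m%:R * x).
Proof.
by move=> lx k; rewrite coord_natM; apply: rpredM; [apply: rpred_nat|apply: lx].
Qed.

Lemma lattice_nth (i : 'I_n.+1) : lattice w`_i.
Proof. by move=> k; rewrite coord_free ?(basis_free bw)// rpred_nat. Qed.

Lemma lattice_mult_mx x i j : lattice x -> mult_mx x i j \is a Num.int.
Proof.
move=> lx; rewrite mxE [x in x * _]expand mulr_suml linear_sum rpred_sum// => k _.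
by rewrite -scalerAl linearZ; apply: rpredM; [apply: lx|apply: wM].
Qed.

Lemma latticeM x y : lattice x -> lattice y -> lattice (x * y).
Proof.
move=> lx ly k; rewrite [y]expand mulr_sumr linear_sum rpred_sum// => i _.
rewrite -scalerAr linearZ; apply: rpredM; first exact: ly.
by have := lattice_mult_mx i k lx; rewrite mxE.
Qed.

Lemma lattice_sum (c : 'I_n.+1 -> rat) :
  (forall i, c i \is a Num.int) -> lattice (\sum_i c i *: w`_i).
Proof. by move=> cP k; rewrite coord_sum_free ?(basis_free bw). Qed.

(** The column of the [w_i] is an eigenvector, with eigenvalue [x], of an integer matrix. *)
Lemma lattice_algint x : lattice x -> algint x.
Proof.
move=> lx; apply/asboolP.
pose M := map_mx Num.floor (mult_mx x); pose W : 'cV[K]_n.+1 := \col_i w`_i.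
apply: (@integral_eigenvalue _ _ intr _ M W).
  apply/eqP => /colP/(_ 0); rewrite !mxE => w0.
  have := basis_not0 bw (mem_nth 0 (_ : 0 < size w)%N).
  by rewrite size_tuple w0 eqxx => /(_ isT).
apply/colP => i; rewrite !mxE [RHS]expand; apply: eq_bigr => j _.
rewrite !mxE -[in RHS](floorK (_ : coord w j (x * w`_i) \is a Num.int)).
  by rewrite scaler_int mulrzl.
by have := lattice_mult_mx i j lx; rewrite mxE.
Qed.

(** The traces of the [w_i x] are integers, and the inverse of the Gram matrix [T] of the trace form
    recovers the coordinates of [x] from them; [d] clears the denominators of this inverse. *)
Lemma algint_denominator :
  exists2 d, (0 < d)%N & forall x, algint x -> lattice (d%:R * x).
Proof.
pose T : 'M[rat]_n.+1 := \matrix_(i, j) \tr (mult_mx (w`_j * w`_i)).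
(* A kernel vector gives [y] orthogonal to all of [K] for the trace form; if [y] were nonzero,
   pairing it with its inverse would give the trace of 1, which is the degree of [K]. *)
have Tu : T \in unitmx.
  rewrite -row_free_unit; apply/inj_row_free => v vT0.
  pose y := \sum_i v 0 i *: w`_i.
  have cy i : coord w i y = v 0 i by rewrite coord_sum_free ?(basis_free bw).
  have tr_wy (i : 'I_n.+1) : \tr (mult_mx (w`_i * y)) = 0.
    rewrite trace_expand -[RHS](_ : (v *m T) 0 i = 0); last by rewrite vT0 mxE.
    by rewrite mxE; apply: eq_bigr => k _; rewrite !mxE cy.
  have y0 : y = 0.
    apply/eqP; apply: contraT => y0.
    have : \tr (mult_mx (y * y^-1)) = 0.
      by rewrite trace_expand big1// => k _; rewrite (mulrC y) tr_wy mulr0.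
    by rewrite divff// rmorph1 mxtrace1 => /eqP; rewrite pnatr_eq0.
  by apply/rowP => i; rewrite mxE -cy y0 linear0.
have [d d0 dP] := common_denominator (fun ij : 'I_n.+1 * 'I_n.+1 => invmx T ij.1 ij.2).
exists d => // x xint k; rewrite coord_natM.
pose X : 'rV[rat]_n.+1 := \row_i coord w i x.
have -> : coord w k x = ((X *m T) *m invmx T) 0 k by rewrite mulmxK// mxE.
rewrite mxE mulr_sumr rpred_sum// => i _.
rewrite mulrCA rpredM//; last exact: (dP (i, k)).
have -> : (X *m T) 0 i = \tr (mult_mx (w`_i * x)).
  by rewrite trace_expand mxE; apply: eq_bigr => j _; rewrite !mxE.
suff : w`_i * x \in @algint K by exact: trace_algint.
by rewrite rpredM//; exact: lattice_algint (lattice_nth i).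
Qed.

(** The norm is a form of degree [n.+1] in the coordinates: each matrix entry is at most
    [S * delta], and the Leibniz formula sums over permutations. *)
Lemma det_bound : exists B : rat, forall delta y, 0 <= delta ->
  (forall k, `|coord w k y| <= delta) -> `|\det (mult_mx y)| <= B * delta ^+ n.+1.
Proof.
pose F i j : rat := \sum_(k < n.+1) `|coord w j (w`_k * w`_i)|.
have F0 i j : 0 <= F i j by exact: sumr_ge0.
pose S : rat := \sum_(i < n.+1) \sum_j F i j.
exists (\sum_(s : 'S_n.+1) S ^+ n.+1) => delta y delta0 ydelta.
have entry i j : `|mult_mx y i j| <= S * delta.
  rewrite mxE [y in y * _]expand mulr_suml linear_sum.
  apply: le_trans (ler_norm_sum _ _ _) _.
  apply: (@le_trans _ _ (F i j * delta)).
    rewrite mulr_suml; apply: ler_sum => k _; rewrite -scalerAl linearZ normrM mulrC.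
    by rewrite ler_wpM2l.
  rewrite ler_wpM2r// /S (bigD1 i)//= (bigD1 j)//= -addrA lerDl addr_ge0//.
    exact: sumr_ge0.
  by apply: sumr_ge0 => *; exact: sumr_ge0.
rewrite /determinant; apply: le_trans (ler_norm_sum _ _ _) _.
rewrite mulr_suml; apply: ler_sum => s _.
rewrite normrM normrX normrN normr1 expr1n mul1r normr_prod -exprMn.
rewrite -[X in _ ^+ X](card_ord n.+1) -prodr_const.
by apply: ler_prod => i _; rewrite normr_ge0 entry.
Qed.

(** Pigeonhole on the fractional parts of the coordinates of [t x]: two multiples in the same box of
    side 1/m differ, up to the lattice, by an element of norm at most B / m^(n+1), which is less
    than 1 as soon as B < m. *)
Lemma hurwitz : exists2 M, (0 < M)%N & forall x, exists t omega,
  [/\ (0 < t <= M)%N, lattice omega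
    & `|\det (mult_mx (t%:R * x - omega))| < 1].
Proof.
have [B BP] := det_bound.
pose m' := Num.truncn B; pose m := m'.+1.
have Bm : B < m%:R.
  by rewrite /m /m'; exact: truncnS_gt.
exists (m ^ n.+1)%N => [|x]; first by rewrite expn_gt0.
pose fr (t : nat) k : rat := t%:R * coord w k x - (Num.floor (t%:R * coord w k x))%:~R.
have fr_ge0 t k : 0 <= fr t k by rewrite subr_ge0 floor_le.
have fr_lt1 t k : fr t k < 1.
  by rewrite ltrBlDl; have := floorD1_gt (t%:R * coord w k x); rewrite intrD.
(* [t] starts at 0, so it takes one value more than there are boxes. *)
pose box (t : 'I_(m ^ n.+1).+1) : {ffun 'I_n.+1 -> 'I_m} :=
  [ffun k => inord (Num.truncn (m%:R * fr t k))].
have boxlt t k : (Num.truncn (m%:R * fr t k) < m)%N.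
  rewrite truncn_lt_nat ?mulr_ge0//. by rewrite gtr_pMr.
have [t1 [t2 [lt12 box12]]] : exists t1 t2 : 'I_(m ^ n.+1).+1,
    (t1 < t2)%N /\ box t1 = box t2.
  have /injectivePn[t1 [t2 t12 bt]] : ~~ injectiveb box.
    by apply/injectiveP => /leq_card; rewrite card_ffun !card_ord ltnn.
  by move: t12; rewrite neq_ltn => /orP[lt|lt]; [exists t1, t2|exists t2, t1].
exists (t2 - t1)%N.
exists (\sum_k (Num.floor (t2%:R * coord w k x)
                - Num.floor (t1%:R * coord w k x))%:~R *: w`_k).
split.
- rewrite subn_gt0 lt12 /= (leq_trans (leq_subr _ _))// -ltnS; exact: ltn_ord.
- by apply: lattice_sum => i; exact: intr_int.
set y := _ - _.
have cy k : coord w k y = fr t2 k - fr t1 k.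
  rewrite /y linearB /= (coord_sum_free (fun i => _%:~R)) ?(basis_free bw)//= coord_natM.
  rewrite natrB ?(ltnW lt12)// rmorphB /fr /=; ring.
have m0 : 0 < m%:R :> rat by rewrite ltr0n.
apply: (@le_lt_trans _ _ (B * m%:R^-1 ^+ n.+1)).
  apply: BP => [|k]; first by rewrite invr_ge0 ltW.
  rewrite cy -[leRHS]mul1r ler_pdivlMr// -[X in _ * X]ger0_norm ?(ltW m0)//.
  rewrite -normrM mulrC mulrBr.
  have /ffunP/(_ k) := box12; rewrite !ffunE => /(congr1 (@nat_of_ord _)).
  rewrite !inordK// => eqt.
  have /andP := truncn_itv (mulr_ge0 (ltW m0) (fr_ge0 t1 k)).
  have /andP := truncn_itv (mulr_ge0 (ltW m0) (fr_ge0 t2 k)).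
  rewrite eqt -natr1 => -[? ?] [? ?].
  by rewrite ler_norml; apply/andP; split; lra.
rewrite exprVn ltr_pdivrMr ?exprn_gt0// mul1r.
apply: lt_le_trans Bm _; rewrite exprS ler_peMr ?(ltW m0)//.
by rewrite exprn_ege1// ler1n.
Qed.

(** * Consequences for the ring of integers and its ideals *)

Local Notation O := (ringOfIntegers K).

Let valM (a b : O) : val (a * b) = val a * val b. Proof. exact: rmorphM. Qed.
Let valB (a b : O) : val (a - b) = val a - val b. Proof. exact: rmorphB. Qed.
Let val_nat m : val (m%:R : O) = m%:R. Proof. exact: rmorph_nat. Qed.
Let val_eq0 (a : O) : (val a == 0) = (a == 0).
Proof. by rewrite -(inj_eq val_inj) (rmorph0 (val : O -> K)). Qed.

Lemma lattice_ring x : lattice x -> exists a : O, val a = x.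
Proof.
move=> lx; have xO : x \in @algint K by exact: lattice_algint.
by exists (RingOfIntegers xO).
Qed.

Lemma val_algint (a : O) : algint (val a). Proof. by case: a. Qed.

(** The class of [x] modulo [N] is determined by the coordinates of [d x] modulo [d N]: if those of
    [x] and [y] agree, then (x - y) / N lies in the lattice. *)
Lemma finite_quotient N : (0 < N)%N -> exists (T : finType) (r : O -> T),
  forall x y, r x = r y -> exists z, x - y = N%:R * z.
Proof.
move=> N0; have [d d0 dP] := algint_denominator; pose L := (d * N)%N.
have L0 : (0 < L)%N by rewrite muln_gt0 d0.
pose c k (x : O) : int := Num.floor (coord w k (d%:R * val x)).
have cE k x : (c k x)%:~R = coord w k (d%:R * val x).
  by apply: floorK; exact: dP (val_algint x) k.
pose r (x : O) : {ffun 'I_n.+1 -> 'I_L.-1.+1} :=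
  [ffun k => inord `|(c k x %% L)%Z|%N].
exists {ffun 'I_n.+1 -> 'I_L.-1.+1}, r => x y /ffunP rxy.
have Lz0 : L%:Z != 0 by rewrite eqz_nat -lt0n.
have dvd k : (L %| c k x - c k y)%Z.
  rewrite -eqz_mod_dvd; have := rxy k; rewrite !ffunE => /(congr1 (@nat_of_ord _)).
  have lt u : (`|(u %% L)%Z| < L.-1.+1)%N.
    rewrite prednK// -ltz_nat gez0_abs ?modz_ge0//.
    by rewrite ltz_pmod.
  rewrite !inordK// => /(congr1 Posz); rewrite !gez0_abs ?modz_ge0//.
  by move=> ->.
have Lr0 : L%:R != 0 :> rat by rewrite pnatr_eq0 -lt0n.
pose z := L%:R^-1 *: (d%:R * (val x - val y)).
have [a az] : exists a : O, val a = z.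
  apply: lattice_ring => k; rewrite /z linearZ mulrBr linearB /= -!cE -intrB.
  have /dvdzP[q ->] := dvd k.
  by rewrite intrM -pmulrn mulrCA mulVf// mulr1 intr_int.
exists a; apply: val_inj; rewrite valM valB val_nat az /z.
rewrite -scalerAr mulrA -natrM mulnC -/L mulr_natl.
by rewrite -(scaler_nat L (_ - _)) scalerA mulVf// scale1r.
Qed.

(** For a nonzero [a] in [I], some positive multiple [N] of the inverse of [a] lies in the lattice,
    and N = (N / a) a. *)
Lemma ideal_nat (I : ideal O) : I != 0 -> exists2 N, (0 < N)%N & I N%:R.
Proof.
move=> /ideal_neq0P[a Ia a0].
have [N N0 NP] := common_denominator (fun k => coord w k (val a)^-1).
exists N => //; have [b bE] : exists b : O, val b = N%:R * (val a)^-1.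
  by apply: lattice_ring => k; rewrite coord_natM.
suff -> : N%:R = b * a by exact: idealMl.
apply: val_inj; by rewrite valM val_nat bE mulfVK// val_eq0.
Qed.

(** Among the nonzero lattice elements of [I], [b] has the least absolute norm. Approximating d a /
    b gives an element t d a - o b of [I] with smaller norm, hence zero. *)
Lemma ideal_hurwitz : exists2 N, (0 < N)%N & forall I : ideal O, I != 0 ->
  exists b, [/\ b != 0, I b & forall a, I a -> exists c, N%:R * a = c * b].
Proof.
have [d d0 dP] := algint_denominator; have [M M0 MP] := hurwitz.
exists (M`! * d)%N => [|I I0]; first by rewrite muln_gt0 fact_gt0.
pose P (m : nat) := `[< exists b : O, [/\ b != 0, I b, lattice (val b)
  & `|\det (mult_mx (val b))| = m%:R] >].
have detN (b : O) : lattice (val b) -> exists m : nat, `|\det (mult_mx (val b))| = m%:R.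
  move=> lb; apply/natrP; rewrite natr_norm_int//.
  rewrite rpred_sum// => s _; rewrite rpredM ?rpred_sign// rpred_prod// => i _.
  exact: lattice_mult_mx.
have exP : exists m, P m.
  have /ideal_neq0P[a Ia a0] := I0.
  have ld : lattice (val (d%:R * a)).
    by rewrite valM val_nat; exact: dP (val_algint a).
  have [m mE] := detN _ ld; exists m; apply/asboolP; exists (d%:R * a).
  split=> //; last exact: idealMl.
  apply: ringOfIntegers_mulf_neq0 => //.
  by rewrite -val_eq0 val_nat -(rmorph_nat (in_alg K)) fmorph_eq0 pnatr_eq0 -lt0n.
have [m /asboolP[b [b0 Ib lb mE]] mmin] := ex_minnP exP.
exists b; split=> // a Ia.
have [t [om [/andP[t0 tM] lom]]] := MP (val (d%:R * a) / val b).
have vb0 : val b != 0 by rewrite val_eq0.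
have [o oE] := lattice_ring lom.
have ly : lattice (val (t%:R * (d%:R * a) - o * b)).
  rewrite valB !valM !val_nat oE; apply: latticeB; last exact: latticeM.
  by apply: lattice_natM; exact: dP (val_algint a).
have Iy : I (t%:R * (d%:R * a) - o * b).
  rewrite -mulNr; apply: idealD; last exact: idealMl.
  by do 2 apply: idealMl.
have [m' m'E] := detN _ ly.
move=> lt1.
have yE : t%:R * (val (d%:R * a) / val b) - om
    = val (t%:R * (d%:R * a) - o * b) / val b.
  by rewrite valB (valM t%:R) val_nat (valM o) oE mulrBl mulfK// mulrA.
have /eqP y0 : t%:R * (d%:R * a) - o * b == 0.
  apply: contraT => y0; have : (m <= m')%N.
    by apply: mmin; apply/asboolP; exists (t%:R * (d%:R * a) - o * b).
  rewrite leqNgt -(ltr_nat rat) -m'E -mE.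
  rewrite -[X in mult_mx X](mulfVK vb0) -yE rmorphM det_mulmx normrM.
  by rewrite gtr_pMl ?normr_gt0 ?mult_mx_unit// lt1.
(* [t] varies with [a] but is at most [M]; the factorial makes the multiplier uniform. *)
have /dvdnP[q qE] : (t %| M`!)%N by rewrite dvdn_fact// t0.
exists (q%:R * o); rewrite qE -mulrA -(subr0_eq y0).
by rewrite !natrM !mulrA.
Qed.
End IntegralBasis.

(** * Finiteness of the class group *)

Lemma ringOfIntegers_quotient (K : fieldExtType rat) N : (0 < N)%N ->
  exists (T : finType) (r : ringOfIntegers K -> T),
    forall x y, r x = r y -> exists z, x - y = N%:R * z.
Proof.
by have [n [w [bw wM]]] := integral_basis K; exact: finite_quotient bw wM N.
Qed.

Lemma nat_in_ideal (K : fieldExtType rat) (I : ideal (ringOfIntegers K)) :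
  I != 0 -> exists2 N, (0 < N)%N & I N%:R.
Proof. by have [n [w [bw wM]]] := integral_basis K; exact: ideal_nat bw wM I. Qed.

Lemma ideal_congr (R : comNzRingType) (I : ideal R) N x y z :
  I N -> I y -> x - y = N * z -> I x.
Proof.
move=> IN Iy /(canRL (subrK _)) ->; apply: idealD => //.
by rewrite mulrC; exact: idealMl.
Qed.

(** Each ideal [I] is equivalent to an ideal [J] containing [N], and such a [J] is determined by its
    image in the finite type [T]; so [cls] reaches every class from a subset of [T]. *)
Lemma class_group_finite (K : fieldExtType rat) : finite_set [set: class_group K].
Proof.
have [n [w [bw wM]]] := integral_basis K.
have [N N0 NP] := ideal_hurwitz bw wM.
have [T [r rP]] := ringOfIntegers_quotient K N0.
pose traces (J : nzideal K) (S : {set T}) :=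
  J N%:R /\ forall t, t \in S <-> exists2 x, J x & r x = t.
(* The trivial class is a default for subsets that are not the image of such an ideal. *)
pose cls (S : {set T}) : class_group K :=
  if pselect (exists J, traces J S) is left ex then ideal_class (projT1 (cid ex))
  else class_one K.
have traces_inj J J' S : traces J S -> traces J' S -> J = J'.
  have sub J1 J2 : traces J1 S -> traces J2 S -> forall x, J1 x -> J2 x.
    move=> [_ tr1] [J2N tr2] x J1x.
    have /tr2[y J2y /esym/rP[z xyz]] : r x \in S by apply/tr1; exists x.
    exact: ideal_congr J2N J2y xyz.
  by move=> tr tr'; apply: val_inj; apply: idealP => x; split; exact: sub.
apply: (sub_finite_set _ (finite_image cls (finite_finset (X := setT)))).
move=> c _; have [I <-] : exists I, ideal_class I = c.
  by eexists; exact: ideal_class_repr.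
have [b [b0 Ib bP]] := NP _ (nzidealP I).
(* This is the ideal (N / b) I, which lies in the ring by the choice of [b] and contains [N] because
   [b] is in [I]. *)
have J_ax : ideal_axiom [set x | exists2 a, (I : ideal _) a & N%:R * a = x * b].
  split=> [|x y [a Ia ax] [a' Ia' a'y]|u x [a Ia ax]].
  - by exists 0; [exact: ideal0|rewrite mulr0 mul0r].
  - by exists (a + a'); [exact: idealD|rewrite mulrDl mulrDr ax a'y].
  - by exists (u * a); [exact: idealMl|rewrite mulrCA ax mulrA].
pose J := Ideal J_ax.
have Nr0 : N%:R != 0 :> ringOfIntegers K.
  rewrite -(inj_eq val_inj) rmorph_nat rmorph0 -(rmorph_nat (in_alg K)).
  by rewrite fmorph_eq0 pnatr_eq0 -lt0n.
have JN : J N%:R by exists b; rewrite // mulrC.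
have J0 : J != 0 by apply/ideal_neq0P; exists N%:R.
exists [set t | `[< exists2 x, J x & r x = t >]]%SET => //.
rewrite /cls; case: pselect => [ex|[]]; last first.
  exists (NzIdeal J0); split=> // t; rewrite inE; split=> [/asboolP//|?].
  exact/asboolP.
have -> : projT1 (cid ex) = NzIdeal J0.
  apply: traces_inj (projT2 (cid ex)) _; split=> // t; rewrite inE.
  by split=> [/asboolP//|?]; exact/asboolP.
apply/ideal_classP/asboolP.
exists b, N%:R; split=> //=; apply: idealP => x; split.
  apply: ideal_mul_sub => _ y [s ->] [a Ia ay].
  have -> : s * b * y = N%:R * (s * a) by rewrite mulrCA ay (mulrC y) mulrA.
  by apply: mem_ideal_mul; [exists 1; rewrite mul1r|exact: idealMl].
apply: ideal_mul_sub => _ a [s ->] Ia; have [y ay] := bP a Ia.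
have -> : s * N%:R * a = b * (s * y) by rewrite -mulrA ay mulrA mulrC.
apply: mem_ideal_mul; first by exists 1; rewrite mul1r.
by apply: idealMl; exists a.
Qed.

(** Generators are a positive integer [N] of [I], at index [None], and one element of [I] for each
    residue class modulo [N] that meets [I]. *)
Lemma ideal_fg (K : fieldExtType rat) (I : ideal (ringOfIntegers K)) : I != 0 ->
  exists m (v : 'I_m -> ringOfIntegers K), (forall i, I (v i)) /\
    forall x, I x -> exists a : 'I_m -> ringOfIntegers K, x = \sum_i a i * v i.
Proof.
move=> I0; have [N N0 IN] := nat_in_ideal I0.
have [T [r rP]] := ringOfIntegers_quotient K N0.
(* Classes that do not meet [I] get the harmless generator 0. *)
have repP t : exists y, I y /\ ((exists2 x, I x & r x = t) -> r y = t).
  have [[x Ix <-]|no] := pselect (exists2 x, I x & r x = t); first by exists x.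
  by exists 0; split=> //; exact: ideal0.
have [rep repE] := choice repP.
exists #|{: option T}|, (fun i => if enum_val i is Some t then rep t else N%:R).
split=> [i|x Ix]; first by case: (enum_val i) => // t; exact: (repE t).1.
have /esym/rP[z xz] : r (rep (r x)) = r x by apply: (repE _).2; exists x.
exists (fun i => if enum_val i is Some t then (t == r x)%:R else z).
pose F (o : option T) : ringOfIntegers K :=
  (if o is Some t then (t == r x)%:R else z) * (if o is Some t then rep t else N%:R).
transitivity (\sum_o F o); last first.
  rewrite (reindex_onto enum_val enum_rank) /= => [|o _]; last exact: enum_rankK.
  by apply: eq_big => i; rewrite ?enum_valK ?eqxx.
rewrite (bigD1 None)//= (bigD1 (Some (r x)))//= big1 => [|[t|] //]; last first.
  by case/andP => _; rewrite /F (inj_eq Some_inj) => /negPf ->; rewrite mul0r.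
by rewrite /F eqxx mul1r addr0 mulrC -xz subrK.
Qed.

Lemma finite_enum (T : choiceType) (h := #|` fset_set [set: T]|) :
  finite_set [set: T] ->
  exists (en : 'I_h -> T) (rk : T -> 'I_h), cancel en rk /\ cancel rk en.
Proof.
move=> finT; have mem x : x \in fset_set [set: T] by rewrite in_fset_set// in_setT.
have lt x : (index x (fset_set [set: T]) < h)%N by rewrite index_mem mem.
exists (tnth (in_tuple (fset_set [set: T]))), (fun x => Ordinal (lt x)).
split=> [i|x]; last by rewrite (tnth_nth x) nth_index ?mem.
by apply: val_inj; rewrite /= (tnth_nth (tnth (in_tuple _) i)) index_uniq ?fset_uniq.
Qed.

(** * Ideal arithmetic in a commutative ring *)

Section DetModIdeal.
Variables (R : comNzRingType) (I : ideal R).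

Lemma det_mod_ideal n (M N : 'M[R]_n) :
  (forall i j, I (M i j - N i j)) -> I (\det M - \det N).
Proof.
pose eqm x y := I (x - y).
have eqmD x x' y y' : eqm x x' -> eqm y y' -> eqm (x + y) (x' + y').
  by rewrite /eqm opprD addrACA; exact: idealD.
have eqmM x x' y y' : eqm x x' -> eqm y y' -> eqm (x * y) (x' * y').
  move=> xx' yy'; rewrite /eqm -(subrKA (x * y')) -mulrBr -mulrBl.
  by apply: idealD; [|rewrite mulrC]; exact: idealMl.
have eqm0 x : eqm x x by rewrite /eqm subrr; exact: ideal0.
move=> MN; rewrite -/(eqm _ _).
apply: (big_ind2 eqm (eqm0 _) eqmD) => s _; apply: (eqmM _ _ _ _ (eqm0 _)).
by apply: (big_ind2 eqm (eqm0 _) eqmM) => i _; exact: MN.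
Qed.
End DetModIdeal.

Section PrincipalMul.
Variable R : comNzRingType.
Implicit Types (a : R) (L : ideal R).

Lemma principal_mulP a L x : (principal a * L)%R x <-> exists2 l, L l & x = a * l.
Proof.
split=> [|[l Ll ->]]; last by apply: mem_ideal_mul => //; exists 1; rewrite mul1r.
move=> [m [u [v [uP Lv ->]]]]; have /choice[c cE] i : exists c, u i = c * a by exact: uP.
exists (\sum_i c i * v i); first by apply: ideal_sum => i; exact: idealMl.
by rewrite mulr_sumr; apply: eq_bigr => i _; rewrite cE mulrCA mulrA.
Qed.

Lemma ideal_mul_subr (I J : ideal R) x : (I * J)%R x -> J x.
Proof. by apply: ideal_mul_sub => a b _ Jb; exact: idealMl. Qed.

Lemma ideal_mulS (I J I' J' : ideal R) : (forall x, I x -> I' x) ->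
  (forall x, J x -> J' x) -> forall x, (I * J)%R x -> (I' * J')%R x.
Proof.
move=> II' JJ'; apply: ideal_mul_sub => a b Ia Jb.
by apply: mem_ideal_mul; [exact: II'|exact: JJ'].
Qed.

Lemma ideal_top L : L 1 -> L = 1.
Proof.
move=> L1; apply: idealP => x; split=> _; first by exists x; rewrite mulr1.
by rewrite -[x]mulr1; exact: idealMl.
Qed.
End PrincipalMul.

(** * Inverse classes, cancellation and division of ideals *)

Section RingOfIntegersIdeals.
Variable K : fieldExtType rat.
Local Notation O := (ringOfIntegers K).
Implicit Types (I J L : ideal O).

Let valM (a b : O) : val (a * b) = val a * val b. Proof. exact: rmorphM. Qed.
Let val_eq0 (a : O) : (val a == 0) = (a == 0).
Proof. by rewrite -(inj_eq val_inj) (rmorph0 (val : O -> K)). Qed.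

Lemma ringOfIntegers_mulI (a : O) : a != 0 -> injective ( *%R a).
Proof.
move=> a0 x y; move=> /(congr1 val); rewrite !valM => /mulfI e.
by apply: val_inj; apply: e; rewrite val_eq0.
Qed.

Lemma principal_mulI (a : O) : a != 0 -> injective (fun L => principal a * L).
Proof.
move=> a0 L L' e; apply: idealP => x; split=> Lx.
  have : (principal a * L')%R (a * x) by rewrite -e; apply/principal_mulP; exists x.
  by move=> /principal_mulP[y L'y /(ringOfIntegers_mulI a0) ->].
have : (principal a * L)%R (a * x) by rewrite e; apply/principal_mulP; exists x.
by move=> /principal_mulP[y L'y /(ringOfIntegers_mulI a0) ->].
Qed.

Lemma ideal_mul_neq0 I J : I != 0 -> J != 0 -> I * J != 0.
Proof. by move=> I0 J0; exact: nzideal_mul_subproof (NzIdeal I0) (NzIdeal J0). Qed.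

Lemma ideal_exp_neq0 I k : I != 0 -> I ^+ k != 0.
Proof.
move=> I0; elim: k => [|k IHk]; first by rewrite expr0 oner_neq0.
by rewrite exprS ideal_mul_neq0.
Qed.

(** Determinant trick: multiplication by [x] acts on finitely many generators of [I] by a matrix
    over the ring of integers, so [x] is integral over that ring, hence over Z. *)
Lemma stable_algint I (x : K) : I != 0 ->
  (forall a, I a -> exists2 b, I b & val b = x * val a) -> exists c : O, val c = x.
Proof.
move=> I0 xI; have [m [v [Iv vP]]] := ideal_fg I0.
have /choice[A AE] i : exists r : 'I_m -> O, x * val (v i) = \sum_j val (r j) * val (v j).
  have [b Ib <-] := xI _ (Iv i); have [r ->] := vP _ Ib.
  exists r; rewrite (rmorph_sum (val : O -> K)).
  by apply: eq_bigr => j _; rewrite rmorphM.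
suff xO : x \in @algint K by exists (RingOfIntegers xO).
have [p pm px] : integralOver (val : O -> K) x.
  apply: (@integral_eigenvalue _ _ (val : {rmorphism O -> K}) _
    (\matrix_(i, j) A i j) (\col_i val (v i))).
    have /ideal_neq0P[a Ia a0] := I0; apply: contraNneq a0 => v0.
    have [r ->] := vP _ Ia; rewrite big1// => i _.
    have /eqP := congr1 (fun u : 'cV_m => u i 0) v0.
    by rewrite !mxE val_eq0 => /eqP ->; rewrite mulr0.
  by apply/colP => i; rewrite !mxE AE; apply: eq_bigr => j _; rewrite !mxE.
apply/asboolP; apply: integral_root_monic px _; first exact: monic_map.
apply/integral_poly => i; rewrite coef_map.
by case: (p`_i) => y /= /asboolP.
Qed.

(** Nakayama's argument: the generators satisfy v = M v with [M] over [J]. By the adjugate, det(1 -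
    M) kills them, so it vanishes; it is also congruent to 1 modulo [J]. *)
Lemma ideal_mul_id I J : I != 0 -> J * I = I -> J = 1.
Proof.
move=> I0 JI; apply: ideal_top; have [m [v [Iv vP]]] := ideal_fg I0.
have /choice[A AE] i : exists r : 'I_m -> O,
    (forall j, J (r j)) /\ v i = \sum_j r j * v j.
  have : (J * I)%R (v i) by rewrite JI.
  move=> [l [a [b [Ja Ib ->]]]].
  have /choice[c cE] k := vP _ (Ib k).
  exists (fun j => \sum_k a k * c k j); split=> [j|].
    by apply: ideal_sum => k; rewrite mulrC; exact: idealMl.
  under [RHS]eq_bigr do rewrite mulr_suml.
  rewrite exchange_big; apply: eq_bigr => k _; rewrite cE mulr_sumr.
  by apply: eq_bigr => j _; rewrite mulrA.
pose M : 'M[O]_m := \matrix_(i, j) A i j; pose V : 'cV[O]_m := \col_i v i.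
have MV : (1%:M - M) *m V = 0.
  rewrite mulmxBl mul1mx; apply/eqP; rewrite subr_eq0; apply/eqP/colP => i.
  by rewrite !mxE (AE i).2; apply: eq_bigr => j _; rewrite !mxE.
have d0 : \det (1%:M - M) = 0.
  apply/eqP; have /ideal_neq0P[a Ia] := I0; apply: contraNT => d0.
  have [r ->] := vP _ Ia; rewrite big1// => i _.
  have : (\det (1%:M - M) *: V) i 0 = 0.
    by rewrite -mul_scalar_mx -mul_adj_mx -mulmxA MV mulmx0 mxE.
  rewrite !mxE => /eqP; apply: contraTeq => vi0.
  apply: ringOfIntegers_mulf_neq0 => //; apply: contra vi0 => /eqP ->; by rewrite mulr0.
have : J (\det (1%:M : 'M[O]_m) - \det (1%:M - M)).
  by apply: det_mod_ideal => i j; rewrite !mxE opprB addrCA subrr addr0; exact: (AE i).1.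
by rewrite d0 det1 subr0.
Qed.

Lemma principal_divisor I a : a != 0 -> (forall x, I x -> exists c, x = a * c) ->
  exists J, I = principal a * J.
Proof.
move=> a0 Ia; have J_ax : ideal_axiom [set c | I (a * c)].
  split=> [|x y /= ax ay|u x /= ax].
  - by rewrite /= mulr0; exact: ideal0.
  - by rewrite mulrDr; exact: idealD.
  - by rewrite mulrCA; exact: idealMl.
exists (Ideal J_ax); apply: idealP => x; split=> [Ix|/principal_mulP[l /= ? ->]//].
by have [c xE] := Ia x Ix; apply/principal_mulP; exists c; rewrite /= -?xE.
Qed.

(* The pigeonhole principle gives [i < j] and [a, b != 0] with
   [(a) I^i = (b) I^j]; then [I^(j-i)] is the principal ideal of [a/b]. *)
Lemma ideal_pow_principal I : I != 0 ->
  exists k (c : O), [/\ (0 < k)%N, c != 0 & I ^+ k = principal c].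
Proof.
move=> I0; have [en [rk [enK rkK]]] := finite_enum (class_group_finite K).
pose c k := ideal_class (NzIdeal (ideal_exp_neq0 k I0)).
have [i [k [k0 /ideal_classP/asboolP[a [b [a0 b0 ab]]]]]] :
    exists i k, (0 < k)%N /\ c i = c (i + k)%N.
  have /injectivePn[i [j ij cij]] : ~~ injectiveb
      (fun i : 'I_(#|` fset_set [set: class_group K]|).+1 => rk (c i)).
    by apply/injectiveP => /leq_card; rewrite !card_ord ltnn.
  move/(can_inj rkK): cij => cij; move: ij; rewrite neq_ltn => /orP[lt|lt].
    by exists i, (j - i)%N; rewrite subn_gt0 subnKC// ltnW.
  by exists j, (i - j)%N; rewrite subn_gt0 subnKC// ltnW.
rewrite /= exprD in ab; set A := I ^+ i in ab; set B := I ^+ k in ab.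
have A0 : A != 0 by exact: ideal_exp_neq0.
(* From (a) A = (b) A B it follows that a / b maps [A] into itself. *)
have [o oE] : exists o : O, val o = val a / val b.
  apply: (stable_algint A0) => x Ax.
  have : (principal b * (A * B))%R (a * x).
    by rewrite -ab; apply/principal_mulP; exists x.
  move=> /principal_mulP[y]; rewrite mulrC => /ideal_mul_subr Ay axy.
  exists y => //; have := congr1 val axy; rewrite !valM => e.
  by rewrite mulrAC e mulrC mulKf// val_eq0.
have aE : a = b * o by apply: val_inj; rewrite valM oE mulrC mulfVK// val_eq0.
have o0 : o != 0 by apply: contra a0 => /eqP o0; rewrite aE o0 mulr0.
rewrite aE -principalM -mulrA in ab; have {}ab := principal_mulI b0 ab.
(* Now (o) A = A B, so y / o maps [A] into itself for each [y] in [B], and [B] lies in (o). *)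
have [J BJ] : exists J, B = principal o * J.
  apply: principal_divisor => // y By.
  have [z zE] : exists z : O, val z = val y / val o.
    apply: (stable_algint A0) => x Ax.
    have : (principal o * A)%R (y * x).
      by rewrite ab [A * B]mulrC; exact: mem_ideal_mul.
    move=> /principal_mulP[u Au yxu]; exists u => //.
    have := congr1 val yxu; rewrite !valM => e.
    by rewrite mulrAC e mulrC mulKf// val_eq0.
  by exists z; apply: val_inj; rewrite valM zE mulrC mulfVK// val_eq0.
have J1 : J = 1.
  apply: (ideal_mul_id A0); apply: (principal_mulI o0).
  by rewrite /= ab BJ [A * _]mulrC -mulrA.
by exists k, o; split=> //; rewrite -/B BJ J1 mulr1.
Qed.

Lemma ideal_inverse I : I != 0 ->
  exists J c, [/\ J != 0, c != 0 & I * J = principal c].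
Proof.
move=> I0; have [k [c [k0 c0 Ic]]] := ideal_pow_principal I0.
case: k k0 Ic => // k _ Ic.
by exists (I ^+ k), c; split=> //; [exact: ideal_exp_neq0|rewrite -exprS].
Qed.

Lemma ideal_mulI I : I != 0 -> injective (fun L => I * L).
Proof.
move=> /ideal_inverse[J [c [J0 c0 IJ]]] L L' /(congr1 (fun A => J * A)) /=.
by rewrite !mulrA ![J * I]mulrC IJ; exact: principal_mulI.
Qed.

(** If J inverts [I] up to the principal ideal (c), then L J lies in I J = (c), and the quotient of
    L J by [c] is the cofactor [D]. *)
Lemma ideal_contain_divide I L : I != 0 -> (forall x, L x -> I x) ->
  exists D, L = I * D.
Proof.
move=> I0 LI; have [J [c [J0 c0 IJ]]] := ideal_inverse I0.
have [D DE] : exists D, L * J = principal c * D.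
  apply: principal_divisor => // x /(ideal_mulS LI (fun _ => id)).
  by rewrite IJ => -[r ->]; exists r; rewrite mulrC.
exists D; apply: (principal_mulI c0) => /=.
by rewrite mulrCA -DE -IJ mulrC mulrCA mulrC.
Qed.
End RingOfIntegersIdeals.

(** * Unique factorization *)

Section PrimeFactorization.
Variables (K : fieldExtType rat) (g : nat) (p : 'I_g -> ideal (ringOfIntegers K)).
Hypotheses (p_inj : injective p) (p_prime : forall i, is_prime (p i))
  (p_neq0 : forall i, p i != 0).
Local Notation O := (ringOfIntegers K).
Implicit Types (I J P : ideal O) (e f : 'I_g -> nat).

Lemma prime_ideal_mul P I J : is_prime P -> (forall x, (I * J)%R x -> P x) ->
  (forall x, I x -> P x) \/ (forall x, J x -> P x).
Proof.
move=> [_ Pp] IJP; have [|no] := pselect (forall x, I x -> P x); first by left.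
right=> y Jy; have [x [Ix nPx]] : exists x, I x /\ ~ P x.
  apply: contrapT => no'; apply: no => x Ix; apply: contrapT => nPx.
  by apply: no'; exists x.
by have /Pp[] : P (x * y) by apply: IJP; exact: mem_ideal_mul.
Qed.

Definition pprod e : ideal O := \prod_i p i ^+ e i.

Lemma pprod_neq0 e : pprod e != 0.
Proof.
rewrite /pprod; elim/big_ind: _ => [|I J|i _]; first exact: oner_neq0.
  exact: ideal_mul_neq0.
exact: ideal_exp_neq0.
Qed.

Lemma eq_pprod e f : e =1 f -> pprod e = pprod f.
Proof. by move=> ef; apply: eq_bigr => i _; rewrite ef. Qed.

Lemma pprodD e f : pprod (fun i => e i + f i)%N = pprod e * pprod f.
Proof. by rewrite /pprod -big_split; apply: eq_bigr => i _; rewrite exprD. Qed.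

Lemma pprod_delta i : pprod (fun j => j == i) = p i.
Proof.
rewrite /pprod (bigD1 i) //= eqxx expr1 big1 ?mulr1// => j /negPf ->.
by rewrite expr0.
Qed.

Lemma pprod0 e : (forall i, e i = 0%N) -> pprod e = 1.
Proof. by move=> e0; rewrite /pprod big1// => i _; rewrite e0 expr0. Qed.

Lemma pprod_pick i e : (0 < e i)%N ->
  pprod e = p i * pprod (fun j => e j - (j == i))%N.
Proof.
move=> ei; rewrite -[X in X * _]pprod_delta -pprodD; apply: eq_pprod => j.
by rewrite subnKC//; case: eqP => [->|].
Qed.

Lemma sum_decr_lt i e : (0 < e i)%N ->
  (\sum_j (e j - (j == i)) < \sum_j e j)%N.
Proof.
move=> ei; rewrite (bigD1 i)//= [X in (_ < X)%N](bigD1 i)//=.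
rewrite eqxx -addSn subn1 prednK// leq_add2l.
by apply: leq_sum => j _; exact: leq_subr.
Qed.

Lemma prime_pprod P e : is_prime P -> (forall x, pprod e x -> P x) ->
  exists2 i, (0 < e i)%N & forall x, p i x -> P x.
Proof.
move=> Pp; have nP1 : ~ forall x, (1 : ideal O) x -> P x.
  by move=> P1; apply: (Pp.1); apply: P1; exists 1; rewrite mulr1.
rewrite /pprod; elim/big_ind: _ => [//|I J IHI IHJ /(prime_ideal_mul Pp)[]//|i _].
have [->|ei] := posnP (e i); first by rewrite expr0.
move=> ik; exists i => //; move: ik; rewrite -(prednK ei).
elim: (e i).-1 => [|k IHk]; first by rewrite expr1.
by rewrite exprS => /(prime_ideal_mul Pp)[].
Qed.

(** If p_j = p_i D with [p_i] not inside [p_j], then D = p_j E by primality, and cancelling [p_j]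
    makes [p_i] a divisor of the unit ideal. *)
Lemma prime_sub_eq i j : (forall x, p j x -> p i x) -> j = i.
Proof.
move=> sub; apply: p_inj.
have [D jD] := ideal_contain_divide (p_neq0 i) sub.
have [|ij|Dj] := @prime_ideal_mul (p j) (p i) D (p_prime j).
- by move=> x; rewrite -jD.
- by apply: idealP => x; split; [exact: sub|exact: ij].
have [E DE] := ideal_contain_divide (p_neq0 j) Dj.
have E1 : p i * E = 1.
  apply: (ideal_mulI (p_neq0 j)) => /=.
  by rewrite mulrCA -DE -jD mulr1.
case: (p_prime i) => -[]; have : (p i * E)%R 1.
  by rewrite E1; exists 1; rewrite mulr1.
by rewrite mulrC; exact: ideal_mul_subr.
Qed.

(** Induction on the total exponent: a prime [p_i] that occurs contains [I] or [J], hence divides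
    it, and is cancelled. *)
Lemma pprod_divisor e I J : I * J = pprod e ->
  exists2 f, (forall i, (f i <= e i)%N) & I = pprod f.
Proof.
have [n] := ubnP (\sum_i e i)%N; elim: n e I J => // n IHn e I J len IJ.
have [[i ei]|noe] := pselect (exists i, (0 < e i)%N); last first.
  have e0 i : e i = 0%N by case: (posnP (e i)) => // ei; case: noe; exists i.
  exists e => //; rewrite pprod0//.
  apply: ideal_top; have : (I * J)%R 1.
    by rewrite IJ pprod0//; exists 1; rewrite mulr1.
  by rewrite mulrC; exact: ideal_mul_subr.
have sum_lt : (\sum_j (e j - (j == i)) < n)%N.
  by apply: leq_trans (sum_decr_lt ei) _; rewrite -ltnS.
have IJi : I * J = p i * pprod (fun j => e j - (j == i))%N.
  by rewrite IJ; exact: pprod_pick.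
have subIJ x : (I * J)%R x -> p i x.
  by rewrite IJi mulrC; exact: ideal_mul_subr.
case: (prime_ideal_mul (p_prime i) subIJ) => sub.
  have [D ID] := ideal_contain_divide (p_neq0 i) sub.
  have [|f fe Df] := IHn _ D J sum_lt.
    by apply: (ideal_mulI (p_neq0 i)); rewrite /= -IJi ID mulrA.
  exists (fun j => (j == i) + f j)%N => [j|]; last by rewrite pprodD pprod_delta -Df.
  have := fe j; have [->|_] := eqVneq j i; last by rewrite subn0.
  by rewrite /=; move: ei; lia.
have [D JD] := ideal_contain_divide (p_neq0 i) sub.
have [|f fe If] := IHn _ I D sum_lt.
  by apply: (ideal_mulI (p_neq0 i)); rewrite /= -IJi JD mulrCA.
by exists f => // j; apply: leq_trans (fe j) (leq_subr _ _).
Qed.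

(** Induction on the total exponent: a prime that occurs on one side contains a prime from the
    other, hence equals it, and one copy is cancelled. *)
Lemma pprod_inj e f : pprod e = pprod f -> e =1 f.
Proof.
have [n] := ubnP (\sum_i e i)%N; elim: n e f => // n IHn e f len ef.
have contained e' i : (0 < e' i)%N -> forall x, pprod e' x -> p i x.
  by move=> ei x; rewrite (pprod_pick ei) mulrC; exact: ideal_mul_subr.
have pos e1 e2 i : pprod e1 = pprod e2 -> (0 < e1 i)%N -> (0 < e2 i)%N.
  move=> e12 e1i; have [|j e2j ji] := @prime_pprod (p i) e2 (p_prime i).
    by move=> x; rewrite -e12; exact: contained.
  by rewrite -(prime_sub_eq ji).
move=> i; have [e0|ei] := posnP (e i).
  rewrite e0; have [//|fi] := posnP (f i).
  by have := pos f e i (esym ef) fi; rewrite e0.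
have fi := pos _ _ _ ef ei.
have /(_ i) : (fun j => e j - (j == i))%N =1 (fun j => f j - (j == i))%N.
  apply: IHn.
    by apply: leq_trans (sum_decr_lt ei) _; rewrite -ltnS.
  by apply: (ideal_mulI (p_neq0 i)); rewrite /= -!(@pprod_pick i).
by rewrite eqxx !subn1 => e1; rewrite -(prednK ei) e1 prednK.
Qed.
End PrimeFactorization.

(** * Counting principal divisors *)

Lemma characters_enum (G : monoidType) (C : numClosedFieldType)
    (h := #|` fset_set [set: G]|) :
  finite_set [set: G] -> commutative (@mul G) ->
  (forall x : G, exists y, (x * y)%g = 1%g) ->
  exists chi : 'I_h -> G -> C, set_bij [set: 'I_h] (characters G C) chi
    /\ forall x, \sum_i chi i x = if x == 1%g then h%:R else 0.
Proof.
move=> finG mulC mulV; have [en [rk [enK rkK]]] := finite_enum finG.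
rewrite -/h in en rk enK rkK *; clearbody h; case: h => [|h'] in en rk enK rkK *.
  (* [h] is not 0, since the monoid contains 1. *)
  by case: (rk 1%g).
exact: (character_enum C enK rkK mulC mulV).
Qed.

(** * The class group as a group, and characters of ideal products *)

Section Classes.
Variable K : fieldExtType rat.
Local Notation O := (ringOfIntegers K).

Lemma ideal_class_eq1 (I : nzideal K) :
  ideal_class I = 1%g <-> is_principal (I : ideal O).
Proof.
split=> [/ideal_classP/asboolP[a [b [a0 b0]]]|[c Ic]].
  rewrite mulr1 => aI; have : principal b b by exists 1; rewrite mul1r.
  rewrite -aI => /principal_mulP[c Ic bE]; exists c.
  by apply: (principal_mulI a0) => /=; rewrite aI bE principalM.
have c0 : c != 0 by have := nzidealP I; rewrite Ic; apply: contra => /eqP ->.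
apply/ideal_classP/asboolP; exists 1, c; split=> //; first exact: oner_neq0.
by rewrite Ic !principalM mul1r mulr1.
Qed.

Lemma class_mulV (x : class_group K) : exists y, (x * y)%g = 1%g.
Proof.
have [I <-] : exists I, ideal_class I = x by eexists; exact: ideal_class_repr.
have [J [c [J0 c0 IJ]]] := ideal_inverse (nzidealP I).
exists (ideal_class (NzIdeal J0)); rewrite -[LHS]ideal_classM.
by apply/ideal_class_eq1; exists c.
Qed.

Lemma char_pprod (C : fieldType) (chi : class_group K -> C) g
    (p : 'I_g -> nzideal K) (f : 'I_g -> nat) (J : nzideal K) :
  characters (class_group K) C chi ->
  (J : ideal O) = pprod (fun i => p i : ideal O) f ->
  chi (ideal_class J) = \prod_i chi (ideal_class (p i)) ^+ f i.
Proof.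
move=> [chi0 chiM] JE.
(* Extending [chi] by 0 at the zero ideal gives a multiplicative map on all ideals, to which
   [big_morph] applies. *)
pose psi (I : ideal O) : C := if insub I is Some I' then chi (ideal_class I') else 0.
have psiE (I : nzideal K) : psi I = chi (ideal_class I).
  by rewrite /psi (valK I : insub (nzideal_val I) = _).
have psi1 : psi 1 = 1.
  rewrite -[1]/(nzideal_val (nzideal_one K)) psiE.
  apply: (mulfI (chi0 (class_one K))); rewrite mulr1 -/(class_one K) -chiM.
  by rewrite monoid.mulg1.
have psiM : {morph psi : I J / I * J}.
  move=> I J'; have [->|I0] := eqVneq I 0.
    by rewrite mul0r /psi insubF ?mul0r// eqxx.
  have [->|J'0] := eqVneq J' 0.
    by rewrite mulr0 /psi [insub 0]insubF ?mulr0// eqxx.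
  rewrite -[I]/(nzideal_val (NzIdeal I0)) -[J']/(nzideal_val (NzIdeal J'0)).
  by rewrite -[_ * _]/(nzideal_val (nzideal_mul _ _)) !psiE ideal_classM chiM.
rewrite -psiE JE /pprod (big_morph psi psiM psi1); apply: eq_bigr => i _.
rewrite -psiE; elim: (f i) => [|k IHk]; first by rewrite !expr0 psi1.
by rewrite !exprS psiM IHk.
Qed.
End Classes.

Theorem corollary1 (R : realType) (K : fieldExtType rat) (alpha : ringOfIntegers K)
    (g : nat) (p : 'I_g -> nzideal K) (e : 'I_g -> nat) :
  alpha != 0 ->
  prime_factorization (principal alpha) (fun i => p i : ideal (ringOfIntegers K)) e ->
  (num_principal_divisors alpha)%:R =
    (class_number K)%:R^-1 *
    \sum_(chi \in characters (class_group K) R[i])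
      \prod_(i < g) \sum_(0 <= k < (e i).+1) chi (ideal_class (p i)) ^+ k
    :> R[i].
Proof.
move=> alpha0 [p_inj p_prime e_gt0 alphaE].
have finG := class_group_finite K.
have [chi [chi_bij chi_sum]] : exists chi : 'I_(class_number K) -> class_group K -> R[i],
    set_bij [set: 'I_(class_number K)] (characters (class_group K) R[i]) chi
    /\ forall x, \sum_i chi i x = if x == 1%g then (class_number K)%:R else 0.
  exact: characters_enum finG (@class_mulC K) (@class_mulV K).
pose P := pprod (fun i => p i : ideal (ringOfIntegers K)).
have p0 i : (p i : ideal (ringOfIntegers K)) != 0 := nzidealP (p i).
(* A common bound for the exponents puts all exponent vectors in one finite function type, where [Q]
   imposes f_i <= e_i. *)
pose N := (\sum_i e i)%N.
have eN i : (e i <= N)%N by rewrite /N (bigD1 i)//= leq_addr.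
pose Q i : pred 'I_N.+1 := fun k => (k <= e i)%N.
pose PP (f : {ffun 'I_g -> 'I_N.+1}) := P (fun i => f i).
have PP0 f : PP f != 0 by exact: pprod_neq0.
pose cls f := ideal_class (NzIdeal (PP0 f)).
have PP_inj : injective PP.
  move=> f1 f2 /(pprod_inj p_inj p_prime p0) f12.
  by apply/ffunP => i; apply: val_inj; exact: f12.
pose S := [set f | f \in family Q & cls f == 1%g]%SET.
have divisorsE : [set J | ideal_divisor (principal alpha) J /\ is_principal J]
    = [set` [fset PP f | f in S]%fset].
  apply/seteqP; split=> J /=.
    move=> [[g' [q [e' [f' [[_ _ _ qE] f'e' JE]]]]] Jpr].
    (* The divisor may come with another factorization, over primes [q]; only its complementary
       divisor is used to rewrite it over the [p_i]. *)
    have [|f fe Jf] := pprod_divisor p_prime p0 (e := e) (I := J)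
      (J := \prod_i q i ^+ (e' i - f' i)).
      rewrite -[RHS]alphaE qE JE -big_split; apply: eq_bigr => i _.
      by rewrite /= -exprD subnKC.
    pose F : {ffun 'I_g -> 'I_N.+1} := [ffun i => inord (f i)].
    have FE i : F i = f i :> nat.
      by rewrite ffunE inordK// ltnS (leq_trans (fe i)).
    have PPF : PP F = J by rewrite Jf; apply: eq_pprod.
    apply/imfsetP; exists F => //=; rewrite inE; apply/andP; split.
      by apply/familyP => i; rewrite unfold_in /Q FE.
    by apply/eqP/ideal_class_eq1; rewrite /= PPF.
  move=> /imfsetP[f /=]; rewrite inE => /andP[/familyP fQ /eqP/ideal_class_eq1 fpr] ->.
  split=> //; exists g, (fun i => p i : ideal _), e, (fun i => nat_of_ord (f i)).
  by split=> [|i|]; [split|exact: fQ|].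
have -> : num_principal_divisors alpha = #|S|.
  rewrite /num_principal_divisors divisorsE set_fsetK card_in_imfset /=.
    by rewrite -cardE.
  by move=> f1 f2 _ _; exact: PP_inj.
(* Finiteness matters here: [fset_set] of an infinite set would have cardinal 0. *)
have h0 : (class_number K)%:R != 0 :> R[i].
  rewrite pnatr_eq0 -lt0n /class_number cardfs_gt0.
  by apply/fset0Pn; exists 1%g; rewrite in_fset_set// in_setT.
apply: (mulfI h0); rewrite mulrA divff// mul1r.
have chi_bij' : set_bij [set` index_enum 'I_(class_number K)]
    (characters (class_group K) R[i]) chi.
  suff -> : [set` index_enum 'I_(class_number K)] = [set: 'I_(class_number K)] by [].
  by apply/seteqP; split=> i //= _; exact: mem_index_enum.
rewrite (reindex_fsbig _ _ _ _ chi_bij') -fsbig_seq ?index_enum_uniq//.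
(* By orthogonality each [f] contributes [h] if its ideal is principal and 0 otherwise, so this
   double sum is [h] times the cardinal of [S]. *)
transitivity (\sum_(f | f \in family Q) \sum_i chi i (cls f)).
  under eq_bigr do rewrite chi_sum.
  rewrite -big_mkcondr sumr_const mulr_natr; congr (_ *+ _).
  by apply: eq_card => f; rewrite !inE.
rewrite exchange_big; apply: eq_bigr => i _.
have chiC : characters (class_group K) R[i] (chi i) by case: chi_bij => + _ _; apply.
(* Widening each inner sum to the common index type allows the product of sums to be expanded over
   the vectors [f]. *)
transitivity (\prod_j \sum_(k | Q j k) chi i (ideal_class (p j)) ^+ k); last first.
  apply: eq_bigr => j _; rewrite big_mkord (big_ord_widen N.+1 (fun k => _ ^+ k)).
    by apply: eq_bigl.
  by rewrite ltnS.
rewrite bigA_distr_big_dep; apply: eq_bigr => f _.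
exact: (char_pprod chiC).
Qed.
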